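(* Let $n\geq 1$ and let $\lambda=(\lambda_1,\ldots,\lambda_n)$ be a partition with $\lambda_1\geq\cdots\geq\lambda_n\geq 0$ integers. Let $Z_\lambda(x|a)$ be the partition function of the six vertex model with the $\lambda$-boundary condition and the Boltzmann weights described in the context. Then \[ Z_\lambda(x|a)=\frac{x^\delta}{a^{(\lambda+\rho)'}}\,s_\lambda(x|a), \] where $s_\lambda(x|a)$ is the factorial Schur function.
   Context: Variables: $x_1,\ldots,x_n$ and $a_1,a_2,\ldots$ are indeterminates. Model: Consider the grid of vertices $(i,j)$ with $1\le i\le n$ (rows, numbered from top to bottom) and $1\le j\le n+\lambda_1$ (columns, numbered from left to right). The edges are the horizontal edges between $(i,j)$ and $(i,j+1)$, the vertical edges between $(i,j)$ and $(i+1,j)$, and boundary edges: a west boundary edge at each vertex of column $1$, an east boundary edge at each vertex of column $n+\lambda_1$, a north boundary edge at each vertex of row $1$, and a south boundary edge at each vertex of row $n$. A state (''square ice'') places on every edge one hydrogen atom bonded to exactly one endpoint of that edge (for a boundary edge: either to its grid vertex or to the outside), such that every vertex (oxygen atom) is bonded to exactly two of the hydrogen atoms on its four incident edges. The $\lambda$-boundary condition requires: all west and east boundary hydrogens are bonded to their grid vertex; no south boundary hydrogen is bonded to its grid vertex; the north boundary hydrogen in column $j$ is bonded to the vertex $(1,j)$ if and only if $j\notin\{\lambda_i+n+1-i: 1\le i\le n\}$. The Boltzmann weight of vertex $(i,j)$ in a state is $x_i/a_j$ if the two hydrogens bonded to it lie on its north and south edges, $x_i/a_j-1$ if they lie on its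 north and west edges, and $1$ in the other four cases. $Z_\lambda(x|a)$ is the sum over all states satisfying the $\lambda$-boundary condition of the product over all vertices of their weights. Notation: for $y=(y_1,y_2,\ldots)$ and a multi-index $\mu=(\mu_1,\mu_2,\ldots)$, $y^\mu=y_1^{\mu_1}y_2^{\mu_2}\cdots$. $\rho=(n-1,n-2,\ldots,0)$, $\delta=(0,1,\ldots,n-1)$, and for a partition $\nu$, $\nu'$ denotes its conjugate partition. Factorial Schur function: $s_\lambda(x|a)=\sum_T\prod_{\alpha\in\lambda}(x_{T(\alpha)}-a_{T(\alpha)+c(\alpha)})$, the sum over all semistandard Young tableaux $T$ of shape $\lambda$ with entries in $\{1,\ldots,n\}$, the product over cells $\alpha$ of the Young diagram of $\lambda$, where $T(\alpha)$ is the entry of $\alpha$ and $c(\alpha)=j-i$ is the content of the cell $\alpha=(i,j)$ (row $i$, column $j$). *)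

(* Defs.v *)
From HB Require Import structures.
From mathcomp Require Import all_boot all_order all_algebra.

Set Implicit Arguments.
Unset Strict Implicit.
Unset Printing Implicit Defensive.

Import GRing.Theory.
Local Open Scope ring_scope.

(* Conventions.  A partition with n parts (zeros allowed) is an [n.-tuple nat]
   assumed [sorted geq].  The indeterminates x_1, ..., x_n and a_1, a_2, ...
   are [x 1, ..., x n] and [a 1, a 2, ...] for arbitrary functions [nat -> F] into
   an arbitrary field F, so that the field of rational functions is one instance;
   no other value of x or a enters the formulas.  Rows, columns and tableau entries are
   numbered from 0 by their ordinals, hence the shifts [.+1]. *)

Definition mexp (R : comUnitRingType) (y : nat -> R) (mu : seq nat) : R :=
  \prod_(k < size mu) y k.+1 ^+ nth 0%N mu k.

Definition rho (n : nat) : seq nat := mkseq (fun i => n.-1 - i)%N n.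

Definition delta (n : nat) : seq nat := iota 0 n.

Definition add_part (mu nu : seq nat) : seq nat :=
  [seq (p.1 + p.2)%N | p <- zip mu nu].

Definition conj_part (nu : seq nat) : seq nat :=
  [seq count (leq j) nu | j <- iota 1 (head 0%N nu)].

(* The Young diagram: the cell in row i and column j, with j < lam_i. *)
Definition cell (n : nat) (lam : n.-tuple nat) : finType :=
  {i : 'I_n & 'I_(tnth lam i)}.

Definition crow (n : nat) (lam : n.-tuple nat) (c : cell lam) : nat := tag c.

Definition ccol (n : nat) (lam : n.-tuple nat) (c : cell lam) : nat := tagged c.

Definition filling (n : nat) (lam : n.-tuple nat) : finType :=
  {ffun cell lam -> 'I_n}.

Definition semistandard (n : nat) (lam : n.-tuple nat) (T : filling lam) :
    bool :=
  [forall c, forall d,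
     ((crow c == crow d) && (ccol c < ccol d)%N ==> (T c <= T d)%N)
  && ((ccol c == ccol d) && (crow c < crow d)%N ==> (T c < T d)%N)].

(* The subtraction in the index T(c) + j - i never truncates: the entries of
   row i (from 0) of a semistandard tableau are at least i + 1. *)
Definition factorial_schur (F : fieldType) (n : nat) (lam : n.-tuple nat)
    (x a : nat -> F) : F :=
  \sum_(T : filling lam | semistandard T)
    \prod_(c : cell lam)
      (x (T c).+1 - a ((T c).+1 + ccol c - crow c)%N).

Definition ncols (n : nat) (lam : n.-tuple nat) : nat := (n + head 0 lam)%N.

(* One boolean per edge.  In row i the horizontal edges are numbered 0, ..., m
   from west to east, and [s.1 (i, k)] says that the hydrogen on edge k is
   bonded to the east endpoint of that edge.  In column j the vertical edges are
   numbered 0, ..., n from north to south, and [s.2 (k, j)] says that the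
   hydrogen on edge k is bonded to the south endpoint.  The first and last edges
   are the boundary edges, whose outer endpoint is the outside. *)
Definition ice_config (n m : nat) : finType :=
  ({ffun 'I_n * 'I_m.+1 -> bool} * {ffun 'I_n.+1 * 'I_m -> bool})%type.

(* Whether the hydrogen on the given edge at vertex (i, j) is bonded to it. *)
Definition bondW (n m : nat) (s : ice_config n m) (i : 'I_n) (j : 'I_m) : bool :=
  s.1 (i, widen_ord (leqnSn m) j).
Definition bondE (n m : nat) (s : ice_config n m) (i : 'I_n) (j : 'I_m) : bool :=
  ~~ s.1 (i, lift ord0 j).
Definition bondN (n m : nat) (s : ice_config n m) (i : 'I_n) (j : 'I_m) : bool :=
  s.2 (widen_ord (leqnSn n) i, j).
Definition bondS (n m : nat) (s : ice_config n m) (i : 'I_n) (j : 'I_m) : bool :=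
  ~~ s.2 (lift ord0 i, j).

Definition boltzmann (F : fieldType) (x a : nat -> F) (n m : nat)
    (s : ice_config n m) (i : 'I_n) (j : 'I_m) : F :=
  if bondN s i j && bondS s i j then x i.+1 / a j.+1
  else if bondN s i j && bondW s i j then x i.+1 / a j.+1 - 1
  else 1.

Definition square_ice (n m : nat) (s : ice_config n m) : bool :=
  [forall i, forall j,
     (bondN s i j + bondE s i j + bondS s i j + bondW s i j == 2)%N].

Definition lam_columns (n : nat) (lam : n.-tuple nat) : seq nat :=
  [seq (tnth lam i + n + 1 - i.+1)%N | i : 'I_n].

Definition lam_boundary (n : nat) (lam : n.-tuple nat)
    (s : ice_config n (ncols lam)) : bool :=
  [forall i : 'I_n, forall j : 'I_(ncols lam),
    [&& (j.+1 == 1)%N ==> bondW s i j,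
        (j.+1 == ncols lam)%N ==> bondE s i j,
        (i.+1 == n)%N ==> ~~ bondS s i j
      & (i.+1 == 1)%N ==> (bondN s i j == (j.+1 \notin lam_columns lam))]].

Definition partition_function (F : fieldType) (n : nat) (lam : n.-tuple nat)
    (x a : nat -> F) : F :=
  \sum_(s : ice_config n (ncols lam) | square_ice s && lam_boundary s)
    \prod_(i < n) \prod_(j < ncols lam) boltzmann x a s i j.

(* Main.v *)
(* Both sides are alternants divided by a Vandermonde determinant.

   Let [p_1 > ... > p_n] be the exponents [lam_i + n - i] and let [t] be one of
   the variables.  Column operations that kill the entries of the alternant
   [det ((y_j | a)^p_i)] at [y_j = t] leave [(y | a)^p_i - r_i (y | a)^p_(i+1)],
   which is divisible by [y - t]; expanding the quotients by multilinearity
   gives the branching rule that removes the largest entry of the tableaux, so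
   [s_lam] is the alternant over the Vandermonde determinant.

   Removing the first row of the ice, with [t] its variable, is the same column
   reduction, but the quotients are multiplied by [y].  A row is scanned from
   west to east: between two consecutive edges where a path enters from the
   north, the possible exits to the south add up to one column vector [G], with
   [(y - t) G(y) = y (F_p'(y) - r F_p(y))], where [F_p(y)] is the product of
   the [y / a_l - 1] over the columns [l] west of [p]; forbidden exits cancel
   because two equal columns kill the determinant.  The factors [y] accumulate
   to [x^delta].

   The variables need not be distinct in [F]; the Vandermonde determinant is
   cancelled over [{poly F}] after a generic perturbation of the variables. *)
Require Import Defs.
From HB Require Import structures.
From mathcomp Require Import all_boot all_order all_algebra.
From mathcomp Require Import fingroup perm ring zify.

Set Implicit Arguments.
Unset Strict Implicit.
Unset Printing Implicit Defensive.

Import GRing.Theory.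
Local Open Scope ring_scope.

(** * Alternants *)

(** Functions index the rows and variables the columns, so the column reductions of an alternant are
    row operations here. *)
Definition alt (R : comNzRingType) (k : nat) (z : nat -> R)
    (c : nat -> R -> R) : R :=
  \det (\matrix_(i < k, j < k) c i (z j)).

Definition vdm (R : comNzRingType) (k : nat) (z : nat -> R) : R :=
  \prod_(i < k) \prod_(j < i) (z j - z i).

Lemma eq_alt (R : comNzRingType) k (z : nat -> R) (c d : nat -> R -> R) :
  (forall i j, (i < k)%N -> (j < k)%N -> c i (z j) = d i (z j)) ->
  alt k z c = alt k z d.
Proof.
by move=> cd; congr (\det _); apply/matrixP=> i j; rewrite !mxE cd.
Qed.

(** Subtracting [r i] times row [i + 1] from row [i] clears the last column down to its bottom
    entry, and the determinant is expanded there. The ratios are given, so nothing is divided. *)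
Lemma alt_colop (R : comNzRingType) k (z : nat -> R) (c : nat -> R -> R)
    (r : nat -> R) :
  (forall i, (i < k)%N -> c i (z k) = r i * c i.+1 (z k)) ->
  alt k.+1 z c =
    c k (z k) * alt k z (fun i y => c i y - r i * c i.+1 y).
Proof.
move=> cr; rewrite /alt.
set M := \matrix_(i, j) _.
pose N : 'M[R]_k.+1 := \matrix_(i, l) (if l == i.+1 :> nat then r i else 0).
have detU : \det (1%:M - N) = 1.
  rewrite -det_tr det_trig; last first.
    apply/is_trig_mxP=> i j ij; rewrite !mxE -!val_eqE /=.
    by do 2?[case: eqP => [e|_]; first lia]; rewrite subr0.
  by apply: big1 => i _; rewrite !mxE eqxx ltn_eqF // subr0.
rewrite -[\det M]mul1r -detU -det_mulmx.
have UM (i j : 'I_k.+1) : ((1%:M - N) *m M) i j =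
    if (i < k)%N then c i (z j) - r i * c i.+1 (z j) else c i (z j).
  rewrite mulmxBl mul1mx !mxE; case: ltnP => ik.
    have ik1 : (i.+1 < k.+1)%N by [].
    rewrite (bigD1 (Ordinal ik1)) //= !mxE eqxx big1 ?addr0 // => l.
    by rewrite -val_eqE /= !mxE => /negPf ->; rewrite mul0r.
  rewrite big1 ?subr0 // => l _; rewrite !mxE; case: eqP => [e|_].
    by have := ltn_ord l; lia.
  by rewrite mul0r.
rewrite (expand_det_col _ ord_max) (bigD1 ord_max) //= big1 ?addr0; last first.
  move=> i; rewrite -val_eqE /= => ik; rewrite UM /=.
  have ik' : (i < k)%N by have := ltn_ord i; lia.
  by rewrite ik' cr // subrr mul0r.
rewrite UM ltnn /cofactor addnn -signr_odd odd_double expr0 mul1r.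
congr (_ * \det _); apply/matrixP=> i j.
transitivity (((1%:M - N) *m M) (lift ord_max i) (lift ord_max j)).
  by rewrite [LHS]mxE [LHS]mxE.
by rewrite UM !lift_max ltn_ord [RHS]mxE.
Qed.

Lemma vdmS (R : comNzRingType) k (z : nat -> R) :
  vdm k.+1 z = vdm k z * \prod_(i < k) (z i - z k).
Proof. by rewrite /vdm big_ord_recr. Qed.

Lemma alt_scale (R : comNzRingType) k (z : nat -> R) (c : nat -> R -> R)
    (b : R -> R) :
  alt k z (fun i y => b y * c i y) = (\prod_(j < k) b (z j)) * alt k z c.
Proof.
rewrite /alt -det_tr.
transitivity (\det (diag_mx (\row_(j < k) b (z j)) *m
                    (\matrix_(i < k, j < k) c i (z j))^T)).
  congr (\det _); apply/matrixP=> i j.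
  by rewrite mul_diag_mx !mxE.
rewrite det_mulmx det_diag det_tr; congr (_ * _).
by apply: eq_bigr => j _; rewrite mxE.
Qed.

Lemma alt_row_scale (R : comNzRingType) k (z : nat -> R) (s : nat -> R)
    (c : nat -> R -> R) :
  alt k z (fun i y => s i * c i y) = (\prod_(i < k) s i) * alt k z c.
Proof.
rewrite /alt.
transitivity (\det (diag_mx (\row_(i < k) s i) *m
                    (\matrix_(i < k, j < k) c i (z j)))).
  by congr (\det _); apply/matrixP=> i j; rewrite mul_diag_mx !mxE.
rewrite det_mulmx det_diag; congr (_ * _).
by apply: eq_bigr => j _; rewrite mxE.
Qed.

Lemma alt_multilinear (R : comNzRingType) (T : finType) k (z : nat -> R)
    (P : 'I_k -> pred T) (w : 'I_k -> T -> R) (f : 'I_k -> T -> R -> R)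
    (c : nat -> R -> R) :
  (forall (i : 'I_k) y, c i y = \sum_(q | P i q) w i q * f i q y) ->
  alt k z c =
    \sum_(q in family P) (\prod_i w i (q i)) *
      \det (\matrix_(i, j) f i (q i) (z j)).
Proof.
move=> cE; rewrite /alt -det_tr /determinant.
under [LHS]eq_bigr => s _.
  under eq_bigr => i _ do rewrite !mxE cE.
  rewrite (reindex_inj (@perm_inj _ s^-1%g)) /=.
  under eq_bigr => i _ do rewrite permKV.
  rewrite bigA_distr_big_dep /= mulr_sumr.
  over.
rewrite exchange_big; apply: eq_bigr => q _.
rewrite mulr_sumr (reindex_inj invg_inj) /=; apply: eq_bigr => s _.
rewrite odd_permV big_split /= mulrCA; congr (_ * (_ * _)).
by apply: eq_bigr => i _; rewrite mxE invgK.
Qed.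

Lemma alt_rev (R : comNzRingType) k (z : nat -> R) (c : nat -> R -> R) :
  alt k (fun i => z (k.-1 - i)%N) c =
    (-1) ^+ perm (@rev_ord_inj k) * alt k z c.
Proof.
rewrite /alt; set M := \matrix_(i, j) c i (z j).
rewrite -odd_permV -det_perm mulrC -det_mulmx -col_permE; congr (\det _).
apply/matrixP=> i j; rewrite !mxE permE /=; congr (c _ (z _)).
by case: (k) j => [|k'] [j jk] //=; rewrite subSS.
Qed.

(** Reducing with the constant ratio [z k] leaves the factor [y - z k] in every remaining row, which
    matches [vdmS]. *)
Lemma vdm_alt (R : comNzRingType) k (z : nat -> R) :
  vdm k z = alt k z (fun i y => y ^+ (k.-1 - i)).
Proof.
elim: k => [|k IHk]; first by rewrite /vdm big_ord0 /alt det_mx00.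
rewrite vdmS IHk (@alt_colop _ _ _ _ (fun=> z k)); last first.
  by move=> i ik; rewrite -exprS /=; congr (_ ^+ _); lia.
rewrite subnn expr0 mul1r mulrC -(alt_scale k z _ (fun y => y - z k)).
apply: eq_alt => i j ik jk /=.
have -> : (k - i = (k.-1 - i).+1)%N by lia.
have -> : (k - i.+1 = k.-1 - i)%N by lia.
by rewrite exprS mulrBl.
Qed.

(** * Transfer of a row of ice *)

(* The weight of a vertex whose incident edges carry the booleans [h] (west),
   [v] (north), [h'] (east), [v'] (south), and [0] if the ice rule fails there;
   [t * u] stands for [x_i / a_j].  A path runs along the edges carrying [false]. *)
Definition vertex_weight (R : comNzRingType) (t u : R) (h v h' v' : bool) : R :=
  if (v + ~~ h' + ~~ v' + h == 2)%N
  then if v && ~~ v' then t * u else if v && h then t * u - 1 else 1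
  else 0.

(** The rest of a row from column [j] on: [h] is the edge west of it, [bs] the north edges, and
    [Psi] is summed over the south edges. The base case makes a path leave to the east. *)
Fixpoint row (R : comNzRingType) (t : R) (u : nat -> R) (j : nat) (h : bool)
    (bs : seq bool) (Psi : seq bool -> R) : R :=
  if bs is b :: bs' then
    \sum_(h' : bool) \sum_(b' : bool) vertex_weight t (u j) h b h' b' *
      row t u j.+1 h' bs' (fun v => Psi (b' :: v))
  else if h then 0 else Psi [::].

(** Listing the last column first makes the indices decrease, like the exponents of a partition. *)
Fixpoint cols (R : Type) (f : nat -> R -> R) (j : nat) (bs : seq bool) :
    seq (R -> R) :=
  if bs is b :: bs' then
    cols f j.+1 bs' ++ (if b then [::] else [:: f j])
  else [::].

(** The value 0 on lists of the wrong length allows any sequence of south edges, whatever its number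
    of paths. *)
Definition altl (R : comNzRingType) (k : nat) (z : nat -> R)
    (L : seq (R -> R)) : R :=
  if size L == k then alt k z (nth (fun=> 0) L) else 0.

(** Rows are numbered from the bottom; below the last one no path may be left. *)
Fixpoint zrec (R : comNzRingType) (u : nat -> R) (z : nat -> R) (k : nat)
    (bs : seq bool) : R :=
  if k is k'.+1 then row (z k') u 0 true bs (zrec u z k')
  else (all id bs)%:R.

Section RowTransfer.
Variables (R : comNzRingType).
Implicit Types (u z : nat -> R) (t y : R) (L : seq (R -> R)).

Lemma eq_row t u j h bs (Psi1 Psi2 : seq bool -> R) :
  (forall v, Psi1 v = Psi2 v) -> row t u j h bs Psi1 = row t u j h bs Psi2.
Proof.
elim: bs j h Psi1 Psi2 => [|b bs IHbs] j h Psi1 Psi2 eP /=.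
  by rewrite eP.
apply: eq_bigr => h' _; apply: eq_bigr => b' _.
by rewrite (IHbs _ _ _ _ (fun v => eP _)).
Qed.

Lemma row_linear t u j h bs a b (Psi1 Psi2 : seq bool -> R) :
  row t u j h bs (fun v => a * Psi1 v + b * Psi2 v) =
    a * row t u j h bs Psi1 + b * row t u j h bs Psi2.
Proof.
elim: bs j h Psi1 Psi2 => [|b0 bs IHbs] j h Psi1 Psi2 /=.
  by case: h; rewrite ?mulr0 ?addr0.
rewrite !mulr_sumr -big_split; apply: eq_bigr => h' _ /=.
rewrite !mulr_sumr -big_split; apply: eq_bigr => b' _ /=.
by rewrite IHbs; ring.
Qed.

Lemma row_scale t u j h bs a (Psi : seq bool -> R) :
  row t u j h bs (fun v => a * Psi v) = a * row t u j h bs Psi.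
Proof.
have := row_linear t u j h bs a 0 Psi Psi.
by rewrite mul0r addr0 => <-; apply: eq_row => v; rewrite mul0r addr0.
Qed.

Lemma row0 t u j h bs : row t u j h bs (fun=> 0) = 0.
Proof.
rewrite -[RHS](mul0r (row t u j h bs (fun=> 0))) -row_scale.
by apply: eq_row => v; rewrite mul0r.
Qed.

Lemma altl_linear k z L1 L2 a b g1 g2 g :
  (forall y, g y = a * g1 y + b * g2 y) ->
  altl k z (L1 ++ g :: L2) =
    a * altl k z (L1 ++ g1 :: L2) + b * altl k z (L1 ++ g2 :: L2).
Proof.
move=> gE; rewrite /altl !size_cat /=.
case: eqP => [e|_]; last by rewrite !mulr0 addr0.
have sL1 : (size L1 < k)%N by lia.
apply: (determinant_multilinear (i0 := Ordinal sL1)).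
- by apply/rowP=> j; rewrite !mxE !nth_cat /= ltnn subnn /= gE.
- apply/matrixP=> i j; rewrite !mxE !nth_cat /=; case: ltnP => // le1.
  case e1 : (_ - _)%N => //; move: (neq_lift (Ordinal sL1) i).
  by rewrite -val_eqE /= in le1 e1 *; lia.
- apply/matrixP=> i j; rewrite !mxE !nth_cat /=; case: ltnP => // le1.
  case e1 : (_ - _)%N => //; move: (neq_lift (Ordinal sL1) i).
  by rewrite -val_eqE /= in le1 e1 *; lia.
Qed.

Lemma altl_alternate k z L1 L2 g : altl k z (L1 ++ g :: g :: L2) = 0.
Proof.
rewrite /altl size_cat /=; case: eqP => // e.
have s1 : (size L1 < k)%N by lia.
have s2 : ((size L1).+1 < k)%N by lia.
apply: (determinant_alternate (i1 := Ordinal s1) (i2 := Ordinal s2)).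
  by rewrite -val_eqE /= ltn_eqF.
by move=> j; rewrite !mxE !nth_cat /= ltnn subnn ltnNge leqnSn /= subSnn.
Qed.

End RowTransfer.

(** * Scanning one row from west to east *)

Section Scan.
Variables (R : comNzRingType) (u : nat -> R) (t : R).
Variable F : nat -> R -> R.

(** [g] is the weighted sum of the descents available so far to the path that entered last. A column
    without a new path multiplies them by the weight [t * u j - 1] of a vertex that no path meets,
    and adds a descent at [j]. A new path completes [g] by the descent at [j] and starts its own
    vector with [F j]. *)
Fixpoint close (L : seq (R -> R)) (g : R -> R) (j : nat) (bs : seq bool) :
    seq (R -> R) :=
  if bs is b :: bs' then
    if b then close L (fun y => (t * u j - 1) * g y + t * u j * F j y) j.+1 bs'
    else close ((fun y => 1 * g y + 1 * F j y) :: L) (F j) j.+1 bs'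
  else L.

Variables (k : nat) (z : nat -> R).

(** [L] holds the vectors fixed west of column [j]; later south edges go in front. *)
Definition scan (h : bool) (j : nat) (bs : seq bool) (L : seq (R -> R)) : R :=
  row t u j h bs (fun v => altl k z (cols F j v ++ L)).

(** These are the six admissible vertices, sorted by their north and west edges. *)
Lemma scan_cons h j b bs L :
  scan h j (b :: bs) L =
    if b then
      if h then (t * u j - 1) * scan true j.+1 bs L
      else scan false j.+1 bs L + t * u j * scan true j.+1 bs (F j :: L)
    else if h then scan false j.+1 bs L + scan true j.+1 bs (F j :: L)
    else scan false j.+1 bs (F j :: L).
Proof.
have Et h' : row t u j.+1 h' bs
    (fun v => altl k z ((cols F j.+1 v ++ [::]) ++ L)) = scan h' j.+1 bs L.
  by apply: eq_row => v; rewrite cats0.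
have Ef h' : row t u j.+1 h' bs
    (fun v => altl k z ((cols F j.+1 v ++ [:: F j]) ++ L)) =
    scan h' j.+1 bs (F j :: L).
  by apply: eq_row => v; rewrite -catA.
rewrite {1}/scan /= !big_bool /= !Et !Ef /vertex_weight.
by case: h b => [] [] /=; ring.
Qed.

Lemma scan_linear h j bs L a b g1 g2 :
  scan h j bs ((fun y => a * g1 y + b * g2 y) :: L) =
    a * scan h j bs (g1 :: L) + b * scan h j bs (g2 :: L).
Proof.
rewrite /scan -row_linear; apply: eq_row => v.
by rewrite (altl_linear _ _ _ _ (fun=> erefl _)).
Qed.

Lemma scan_linear2 h j bs L a b g0 g1 g2 :
  scan h j bs (g0 :: (fun y => a * g1 y + b * g2 y) :: L) =
    a * scan h j bs (g0 :: g1 :: L) + b * scan h j bs (g0 :: g2 :: L).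
Proof.
rewrite /scan -row_linear; apply: eq_row => v.
by rewrite -cat_rcons (altl_linear _ _ _ _ (fun=> erefl _)) !cat_rcons.
Qed.

Lemma scan_alternate h j bs L g : scan h j bs (g :: g :: L) = 0.
Proof.
rewrite /scan -[RHS](row0 t u j h bs); apply: eq_row => v.
exact: altl_alternate.
Qed.

(* The horizontal path, when open, may still go down at a later column: closing
   it contributes one new column vector, a combination [g] of the [F j]
   accumulated so far. *)
Lemma scan_open j bs L g :
  scan false j bs L + scan true j bs (g :: L) = altl k z (close L g j bs).
Proof.
elim: bs j L g => [|[] bs IHbs] j L g /=.
- by rewrite /scan /= addr0.
- by rewrite -IHbs !scan_cons scan_linear; ring.
(* Multilinearity also yields a term with [F j] twice, two paths going down the same edge; it
   vanishes by [scan_alternate]. *)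
by rewrite -IHbs !scan_cons scan_linear scan_linear2 scan_alternate; ring.
Qed.

End Scan.

(* Entry [i] of [L] is the [G] of the header for the entries [i], [i+1] of [P]:
   [P] lists the particles of a row of ice, the last one first. *)
Definition closes (R : comNzRingType) (t : R) (L P : seq (R -> R)) : Prop :=
  size P = (size L).+1 /\
  forall i, (i < size L)%N -> exists r : R,
    nth (fun=> 0) P i t = r * nth (fun=> 0) P i.+1 t /\
    forall y, (y - t) * nth (fun=> 0) L i y =
      y * (nth (fun=> 0) P i y - r * nth (fun=> 0) P i.+1 y).

(** Applied to [P], [alt_colop] leaves the rows [P_i - r_i P_(i+1)]; times [y], they are the rows of
    [L] times [y - z k]. *)
Lemma altl_closes (R : comNzRingType) k (z : nat -> R) (L P : seq (R -> R)) :
  closes (z k) L P ->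
  (\prod_(i < k) (z i - z k)) * (last (fun=> 0) P (z k) * altl k z L) =
    (\prod_(i < k) z i) * altl k.+1 z P.
Proof.
move=> [sP LP]; rewrite /altl sP eqSS; case: eqP => [sL|_]; last by rewrite !mulr0.
rewrite sL in LP sP.
have [r rP] := fin_all_exists (fun i : 'I_k => LP i (ltn_ord i)).
pose r' i := oapp r 0 (insub i).
have r'E (i : 'I_k) : r' i = r i by rewrite /r' valK.
rewrite (@alt_colop _ k z _ r'); last first.
  by move=> i ik; have [-> _] := rP (Ordinal ik); rewrite -r'E.
rewrite -nth_last sP /= [LHS]mulrCA [RHS]mulrCA; congr (_ * _).
rewrite -(alt_scale k z _ (fun y => y - z k)) -(alt_scale k z _ id).
apply: eq_alt => i j ik jk; have [_ ->] := rP (Ordinal ik).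
by rewrite -r'E.
Qed.

(** If [u l] is the inverse of [a_(l+1)], this is the factorial power [(y | a)^j] divided by
    [a_1 ... a_j]. *)
Definition fbinom (R : comNzRingType) (u : nat -> R) (j : nat) (y : R) : R :=
  \prod_(l < j) (y * u l - 1).

Lemma fbinomS (R : comNzRingType) (u : nat -> R) j (y : R) :
  fbinom u j.+1 y = fbinom u j y * (y * u j - 1).
Proof. by rewrite /fbinom big_ord_recr. Qed.

(** The invariant of the scan is [(y - t) g = t F_j - r y P_0], with [P_0] the function of the last
    path and [F_j = r P_0] at [t]. A column without a new path multiplies [r] by [t u_j - 1]. At a
    new path, adding [(y - t) F_j] turns [t F_j] into [y F_j], as [closes] demands. *)
Lemma closes_close (R : comNzRingType) (u : nat -> R) (t : R) j bs L P g :
  closes t L P ->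
  (exists r, fbinom u j t = r * nth (fun=> 0) P 0 t /\
     forall y, (y - t) * g y = t * fbinom u j y - y * r * nth (fun=> 0) P 0 y) ->
  closes t (close u t (fbinom u) L g j bs) (cols (fbinom u) j bs ++ P).
Proof.
elim: bs j L P g => [|[] bs IHbs] j L P g //= LP [r [rt gE]].
  rewrite cats0; apply: IHbs => //; exists (r * (t * u j - 1)); split.
    by rewrite fbinomS rt; ring.
  move=> y; rewrite fbinomS mulrDr mulrCA gE; ring.
rewrite -catA /=; apply: IHbs.
  case: LP => sP LP; split=> [|[|i] /= iL]; first by rewrite /= sP.
    by exists r; split=> // y; rewrite !mul1r mulrDr gE; ring.
  exact: LP.
exists (t * u j - 1); split=> [|y] /=; rewrite fbinomS; ring.
Qed.

(** West of the first path every vertex is forced, with weight [z k * u j - 1]. The factor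
    [fbinom u j (z k)] collects these weights until it becomes [last P (z k)] in [altl_closes]. *)
Lemma scan_altl (R : comNzRingType) (u : nat -> R) k (z : nat -> R) j bs :
  (\prod_(i < k) (z i - z k)) *
    (fbinom u j (z k) * scan u (z k) (fbinom u) k z true j bs [::]) =
  (\prod_(i < k) z i) * altl k.+1 z (cols (fbinom u) j bs).
Proof.
elim: bs j => [|[] bs IHbs] j; first by rewrite /scan /altl /= !mulr0.
  by rewrite scan_cons /= cats0 -IHbs fbinomS !mulrA.
have cl : closes (z k) (close u (z k) (fbinom u) [::] (fbinom u j) j.+1 bs)
    (cols (fbinom u) j (false :: bs)).
  apply: closes_close => //; exists (z k * u j - 1).
  by split=> [|y] /=; rewrite fbinomS; ring.
by rewrite scan_cons scan_open -(altl_closes cl) last_cat.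
Qed.

(** Each row splits off its Vandermonde factors and gives one factor [z i] for every row below
    it. *)
Lemma zrec_altl (R : comNzRingType) (u : nat -> R) k (z : nat -> R) bs :
  vdm k z * zrec u z k bs =
    (\prod_(i < k) z i ^+ (k.-1 - i)) * altl k z (cols (fbinom u) 0 bs).
Proof.
elim: k bs => [|k IHk] bs.
  rewrite /vdm !big_ord0 !mul1r /= /altl.
  have -> j : (size (cols (fbinom u) j bs) == 0%N) = all id bs.
    by elim: bs j => [|[] bs IHbs] j //=; rewrite ?cats0 // size_cat addn1.
  by case: ifP => // _; rewrite /alt det_mx00.
rewrite vdmS -mulrA mulrCA /= -row_scale.
under eq_row => v do rewrite IHk.
rewrite row_scale mulrCA.
have := scan_altl u k z 0 bs; rewrite {1}/fbinom big_ord0 mul1r.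
rewrite /scan; under eq_row => v do rewrite cats0.
move=> ->.
rewrite mulrA; congr (_ * _); rewrite big_ord_recr /= subnn expr0 mulr1 -big_split.
apply: eq_bigr => i _ /=; rewrite -exprSr; congr (_ ^+ _).
by have := ltn_ord i; lia.
Qed.

(** * Sums over states *)

Definition fcons (T : Type) m (t : T) (g : {ffun 'I_m -> T}) :
    {ffun 'I_m.+1 -> T} :=
  [ffun i => oapp g t (unlift ord0 i)].

Lemma fcons0 (T : Type) m (t : T) (g : {ffun 'I_m -> T}) : fcons t g ord0 = t.
Proof. by rewrite ffunE unlift_none. Qed.

Lemma fconsS (T : Type) m (t : T) (g : {ffun 'I_m -> T}) j :
  fcons t g (lift ord0 j) = g j.
Proof. by rewrite ffunE liftK. Qed.

Lemma big_ffunS (R : nmodType) (T : finType) m (G : {ffun 'I_m.+1 -> T} -> R) :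
  \sum_f G f = \sum_t \sum_(g : {ffun 'I_m -> T}) G (fcons t g).
Proof.
rewrite pair_big /= (reindex (fun p : T * {ffun 'I_m -> T} => fcons p.1 p.2)) //.
apply: onW_bij.
exists (fun f : {ffun 'I_m.+1 -> T} => (f ord0, [ffun j => f (lift ord0 j)]))
  => [[t g]|f] /=.
  by rewrite fcons0; congr pair; apply/ffunP=> j; rewrite ffunE fconsS.
by apply/ffunP=> i; rewrite ffunE; case: unliftP => [j ->|->] //=; rewrite ffunE.
Qed.

Lemma big_ffun0 (R : nmodType) (T : finType) (G : {ffun 'I_0 -> T} -> R) g :
  \sum_f G f = G g.
Proof.
rewrite (bigD1 g) //= big1 ?addr0 // => f /eqP []; by apply/ffunP=> -[].
Qed.

Lemma codom_ordS (T : Type) m (v : 'I_m.+1 -> T) :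
  codom v = v ord0 :: codom (fun j => v (lift ord0 j)).
Proof. by rewrite /codom /image_mem enum_ordSl /= -map_comp. Qed.

(** A transfer-matrix sum, used twice: along a row, with single horizontal edges as states, and down
    the grid, with whole rows of vertical edges as states. *)
Definition path_sum (R : comNzRingType) (S : finType) m
    (w : 'I_m -> S -> S -> R) (s e : S) : R :=
  \sum_(h : {ffun 'I_m.+1 -> S} | (h ord0 == s) && (h ord_max == e))
    \prod_(j < m) w j (h (widen_ord (leqnSn m) j)) (h (lift ord0 j)).

Lemma path_sum0 (R : comNzRingType) (S : finType)
    (w : 'I_0 -> S -> S -> R) (s e : S) : path_sum w s e = (s == e)%:R.
Proof.
rewrite /path_sum big_mkcond big_ffunS.
under eq_bigr => t _.
  rewrite (big_ffun0 _ [ffun=> t]) big_ord0 (ord1 ord_max) fcons0; over.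
rewrite (bigD1 s) //= eqxx /= big1 ?addr0; first by case: ifP.
by move=> t /negPf ->.
Qed.

Lemma path_sumS (R : comNzRingType) (S : finType) m
    (w : 'I_m.+1 -> S -> S -> R) (s e : S) :
  path_sum w s e =
    \sum_s' w ord0 s s' * path_sum (fun j => w (lift ord0 j)) s' e.
Proof.
rewrite /path_sum big_mkcond big_ffunS (bigD1 s) //= [X in _ + X]big1 ?addr0;
  last first.
  by move=> t /negPf ts; apply: big1 => g _; rewrite fcons0 ts.
under [RHS]eq_bigr => s' _ do rewrite mulr_sumr.
rewrite [RHS](exchange_big_dep predT) //=; apply: eq_bigr => g _.
have -> : ord_max = lift ord0 (ord_max : 'I_m.+1) by apply: val_inj.
rewrite fcons0 fconsS eqxx /=.
case: (boolP (g ord_max == e)) => [ge|ge]; last first.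
  by rewrite big_pred0 // => s'; rewrite andbF.
rewrite (eq_bigl (pred1 (g ord0))); last first.
  by move=> s' /=; rewrite andbT eq_sym.
rewrite big_pred1_eq big_ord_recl; congr (_ * _).
  rewrite (_ : widen_ord _ ord0 = ord0) ?fcons0 ?fconsS //; exact: val_inj.
apply: eq_bigr => j _; rewrite !fconsS; congr (w _ _ _).
rewrite (_ : widen_ord _ _ = lift ord0 (widen_ord (leqnSn m) j)) ?fconsS //.
exact: val_inj.
Qed.

Definition row_sum (R : comNzRingType) m (t : R) (u : nat -> R)
    (h : bool) (v v' : 'I_m -> bool) : R :=
  path_sum (fun j h1 h2 => vertex_weight t (u j) h1 (v j) h2 (v' j)) h false.

Lemma row_sumE (R : comNzRingType) m (t : R) (u : nat -> R) j0 h
    (v : 'I_m -> bool) (Psi : seq bool -> R) :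
  \sum_(v' : {ffun 'I_m -> bool})
    row_sum t (fun j => u (j0 + j)%N) h v v' * Psi (codom v') =
  row t u j0 h (codom v) Psi.
Proof.
elim: m j0 h v Psi => [|m IHm] j0 h v Psi.
  rewrite (big_ffun0 _ [ffun=> true]) /row_sum path_sum0.
  rewrite !(size0nil (etrans (size_codom _) (card_ord 0))) /=.
  by case: h; rewrite ?mul0r ?mul1r.
rewrite big_ffunS codom_ordS /= exchange_big /=.
under eq_bigr => g _ do under eq_bigr => b' _ do
  rewrite codom_ordS /row_sum path_sumS mulr_suml.
transitivity (\sum_h' \sum_b' vertex_weight t (u j0) h (v ord0) h' b' *
  \sum_(g : {ffun 'I_m -> bool}) row_sum t (fun j => u (j0.+1 + j)%N) h'
    (fun j => v (lift ord0 j)) g * Psi (b' :: codom g)).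
  rewrite exchange_big /= [RHS]exchange_big /=; apply: eq_bigr => b' _.
  rewrite exchange_big /=; apply: eq_bigr => h' _.
  rewrite mulr_sumr; apply: eq_bigr => g _.
  rewrite fcons0 addn0 -mulrA; congr (_ * (_ * Psi (_ :: _))).
    apply: eq_bigr => f _; apply: eq_bigr => j _.
    by rewrite fconsS /= /bump /= addnA addn1.
  by apply: eq_codom => j; rewrite fconsS.
apply: eq_bigr => h' _; apply: eq_bigr => b' _; congr (_ * _).
exact: (IHm j0.+1 h' _ (fun w => Psi (b' :: w))).
Qed.

Lemma eq_zrec (R : comNzRingType) (u z z' : nat -> R) k bs :
  (forall i, (i < k)%N -> z i = z' i) -> zrec u z k bs = zrec u z' k bs.
Proof.
elim: k bs => //= k IHk bs zz'; rewrite zz' //; apply: eq_row => v.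
by apply: IHk => i ik; apply: zz'; apply: ltnW.
Qed.

Lemma path_sum_zrec (R : comNzRingType) n m (x u : nat -> R)
    (top : {ffun 'I_m -> bool}) :
  path_sum (fun (i : 'I_n) (v v' : {ffun 'I_m -> bool}) =>
    row_sum (x i) u true v v') top [ffun=> true] =
  zrec u (fun i => x (n.-1 - i)%N) n (codom top).
Proof.
elim: n x top => [|n IHn] x top.
  rewrite path_sum0 /=; congr (_%:R); congr (nat_of_bool _).
  apply/eqP/allP => [-> b /codomP[j ->]|h]; first by rewrite ffunE.
  by apply/ffunP=> j; rewrite ffunE; apply: h; apply: codom_f.
rewrite path_sumS /= subnn.
have := row_sumE (x 0%N) u 0 true top.
move=> /(_ (zrec u (fun i => x (n - i)%N) n)) <-.
apply: eq_bigr => v' _; congr (_ * _).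
rewrite (IHn (fun i => x i.+1)); apply: eq_zrec => i ik; congr x; lia.
Qed.

Definition ice_bc n m (top : {ffun 'I_m -> bool}) (s : ice_config n m) : bool :=
  [forall i, s.1 (i, ord0) && ~~ s.1 (i, ord_max)] &&
  [forall j, (s.2 (ord0, j) == top j) && s.2 (ord_max, j)].

Lemma ice_sum_zrec (R : comNzRingType) n m (x u : nat -> R)
    (top : {ffun 'I_m -> bool}) :
  \sum_(s : ice_config n m | ice_bc top s) \prod_(i < n) \prod_(j < m)
    vertex_weight (x i) (u j) (bondW s i j) (bondN s i j)
      (~~ bondE s i j) (~~ bondS s i j) =
  zrec u (fun i => x (n.-1 - i)%N) n (codom top).
Proof.
rewrite -path_sum_zrec /path_sum.
pose curry k l (f : {ffun 'I_k -> {ffun 'I_l -> bool}}) :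
  {ffun 'I_k * 'I_l -> bool} := [ffun p => f p.1 p.2].
pose uncurry k l (f : {ffun 'I_k * 'I_l -> bool}) :
  {ffun 'I_k -> {ffun 'I_l -> bool}} := [ffun i => [ffun j => f (i, j)]].
have curryK k l : cancel (@curry k l) (@uncurry k l).
  by move=> f; apply/ffunP=> i; apply/ffunP=> j; rewrite !ffunE.
have uncurryK k l : cancel (@uncurry k l) (@curry k l).
  by move=> f; apply/ffunP=> -[i j]; rewrite !ffunE.
rewrite (reindex (fun p => (curry _ _ p.2, curry _ _ p.1) : ice_config n m)) /=;
  last first.
  apply: onW_bij; exists (fun s => (uncurry _ _ s.2, uncurry _ _ s.1)).
    by case=> V H /=; rewrite !curryK.
  by case=> H V /=; rewrite !uncurryK.
rewrite (eq_bigl (fun p : {ffun 'I_n.+1 -> {ffun 'I_m -> bool}} *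
    {ffun 'I_n -> {ffun 'I_m.+1 -> bool}} => ((p.1 ord0 == top) && (p.1 ord_max == [ffun=> true]))
    && (p.2 \in family (fun=> [pred h : {ffun 'I_m.+1 -> bool} |
                         (h ord0 == true) && (h ord_max == false)])))); last first.
  move=> [V H]; rewrite /ice_bc andbC; congr (_ && _) => /=.
    apply/forallP/andP=> [h|[/eqP<- /eqP e] j]; last first.
      by rewrite !ffunE e ffunE eqxx.
    split; apply/eqP/ffunP=> j; have := h j; rewrite !ffunE /=;
      by case/andP => /eqP.
  apply/forallP/familyP=> h i; have := h i; rewrite !ffunE !inE;
    by rewrite eqb_id eqbF_neg.
pose G (V : {ffun 'I_n.+1 -> {ffun 'I_m -> bool}})
  (H : {ffun 'I_n -> {ffun 'I_m.+1 -> bool}}) :=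
  \prod_(i < n) \prod_(j < m) vertex_weight (x i) (u j) (H i (widen_ord (leqnSn m) j))
     (V (widen_ord (leqnSn n) i) j) (H i (lift ord0 j)) (V (lift ord0 i) j).
rewrite (eq_bigr (fun p => G p.1 p.2)) => [|[V H] _]; last first.
  apply: eq_bigr => i _; apply: eq_bigr => j _.
  by rewrite /bondW /bondN /bondE /bondS !ffunE !negbK.
rewrite -(pair_big (fun V : {ffun 'I_n.+1 -> {ffun 'I_m -> bool}} =>
  (V ord0 == top) && (V ord_max == [ffun=> true])) _ G) /=.
apply: eq_bigr => V _.
(* For fixed vertical edges the horizontal edges of different rows are independent, so their sum is
   a product over the rows. *)
by rewrite /row_sum /path_sum bigA_distr_big_dep; apply: eq_bigr.
Qed.

(** Trades the ice rule as a condition on states for vanishing vertex weights. *)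
Lemma prod_if (R : comNzRingType) (I : finType) (C : pred I) (f : I -> R) :
  \prod_i (if C i then f i else 0) = if [forall i, C i] then \prod_i f i else 0.
Proof.
case: ifPn => [/forallP h|].
  by apply: eq_bigr => i _; rewrite h.
by rewrite negb_forall => /existsP[i /negPf hi]; rewrite (bigD1 i) //= hi mul0r.
Qed.

(** * The boundary condition of a partition *)

Definition lam_top n (lam : n.-tuple nat) : {ffun 'I_(ncols lam) -> bool} :=
  [ffun j : 'I_(ncols lam) => j.+1 \notin lam_columns lam].

Lemma lam_boundaryE n (lam : n.-tuple nat) (s : ice_config n (ncols lam)) :
  (0 < n)%N -> lam_boundary s = ice_bc (lam_top lam) s.
Proof.
move=> n0; have m0 : (0 < ncols lam)%N by rewrite addn_gt0 n0.
apply/idP/idP => [/'forall_forallP h|/andP[/forallP h1 /forallP h2]];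
  last first.
  apply/'forall_forallP => i j.
  rewrite /bondW /bondE /bondN /bondS !negbK.
  have /andP[hW hE] := h1 i; have /andP[hN hS] := h2 j.
  apply/and4P; split; apply/implyP => /eqP [e].
  - by rewrite (_ : widen_ord _ _ = ord0) //; apply: val_inj.
  - by rewrite (_ : lift _ _ = ord_max) //; apply: val_inj.
  - by rewrite (_ : lift _ _ = ord_max) //; apply: val_inj.
  - rewrite (_ : widen_ord _ _ = ord0); last exact: val_inj.
    by move: hN; rewrite ffunE.
have n1 : (n.-1 < n)%N by rewrite prednK.
have m1 : ((ncols lam).-1 < ncols lam)%N by rewrite prednK.
apply/andP; split; apply/forallP => k; apply/andP; split.
- have /and4P[+ _ _ _] := h k (Ordinal m0); rewrite /bondW /=.
  by rewrite (_ : widen_ord _ _ = ord0) //; apply: val_inj.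
- have /and4P[_ + _ _] := h k (Ordinal m1); rewrite /bondE /= prednK // eqxx /=.
  by rewrite (_ : lift _ _ = ord_max) //; apply: val_inj; rewrite /= /bump leq0n add1n prednK.
- have /and4P[_ _ _ +] := h (Ordinal n0) k; rewrite /bondN /= ffunE.
  by rewrite (_ : widen_ord _ _ = ord0) //; apply: val_inj.
have /and4P[_ _ + _] := h (Ordinal n1) k; rewrite /bondS /= prednK // eqxx negbK.
by rewrite (_ : lift _ _ = ord_max) //; apply: val_inj; rewrite /= /bump leq0n add1n prednK.
Qed.

Lemma partition_function_zrec (F : fieldType) n (lam : n.-tuple nat)
    (x a : nat -> F) : (0 < n)%N ->
  partition_function lam x a =
    zrec (fun j => (a j.+1)^-1) (fun i => x (n.-1 - i).+1) n
      (codom (lam_top lam)).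
Proof.
move=> n0; rewrite -(ice_sum_zrec n (fun i => x i.+1)) /partition_function.
rewrite big_mkcondl /=; apply: eq_big => [s|s _]; first exact: lam_boundaryE.
rewrite /square_ice; under [in RHS]eq_bigr => i _.
  rewrite /vertex_weight prod_if; over.
rewrite prod_if; congr (if _ then _ else _).
  by apply: eq_forallb => i; apply: eq_forallb => j; rewrite !negbK.
by apply: eq_bigr => i _; apply: eq_bigr => j _; rewrite negbK.
Qed.

Lemma cols_iota (R : Type) (f : nat -> R -> R) (P : pred nat) j m :
  cols f j [seq P i | i <- iota j m] =
    [seq f i | i <- rev [seq i <- iota j m | ~~ P i]].
Proof.
elim: m j => //= m IHm j; rewrite IHm; case: (P j) => /=; first exact: cats0.
by rewrite rev_cons map_rcons cats1.
Qed.

(** The exponents of the alternant, which are also the columns, counted from 0, where paths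
    enter. *)
Definition shifted_part n (lam : n.-tuple nat) : seq nat :=
  mkseq (fun i => nth 0 lam i + n.-1 - i)%N n.

Lemma sorted_nth_le (s : seq nat) i j :
  sorted geq s -> (i <= j)%N -> (nth 0 s j <= nth 0 s i)%N.
Proof.
move=> hs ij; case: (ltnP j (size s)) => js; last by rewrite nth_default.
apply: (sorted_leq_nth (leT := geq)) => //.
- by move=> b a c /= ba cb; exact: leq_trans cb ba.
- by move=> a; apply: leqnn.
by rewrite inE (leq_ltn_trans ij).
Qed.

Lemma cols_lam_top (R : Type) (f : nat -> R -> R) n (lam : n.-tuple nat) :
  sorted geq lam ->
  cols f 0 (codom (lam_top lam)) = [seq f i | i <- shifted_part lam].
Proof.
move=> hlam.
have -> : codom (lam_top lam) =
    [seq i.+1 \notin lam_columns lam | i <- iota 0 (ncols lam)].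
  rewrite -val_enum_ord -map_comp /codom /image_mem.
  by apply: eq_map => j; rewrite ffunE.
rewrite cols_iota; congr map.
have in_lc i : (i.+1 \in lam_columns lam) = (i \in shifted_part lam).
  apply/imageP/mapP => [[k _ e]|[k]]; last rewrite mem_iota => /= kn e.
    by exists (val k); rewrite ?mem_iota ?ltn_ord //= -tnth_nth; have := ltn_ord k; lia.
  by exists (Ordinal kn) => //; rewrite (tnth_nth 0%N) /=; lia.
(* Both lists decrease strictly, so comparing their members is enough. *)
apply: (@irr_sorted_eq _ gtn).
- by move=> i j k /= ji /ltn_trans; apply.
- by move=> i; rewrite /= ltnn.
- rewrite rev_sorted; apply: sorted_filter; last exact: iota_ltn_sorted.
  exact: ltn_trans.
- apply/(sortedP 0%N) => i; rewrite size_mkseq => iN; rewrite !nth_mkseq ?(ltnW iN) //=.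
  by have := sorted_nth_le hlam (leqnSn i); lia.
move=> i; rewrite mem_rev mem_filter negbK in_lc mem_iota /= add0n andbC.
case: (boolP (i \in _)) => [|_]; last by rewrite andbF.
case/mapP=> k; rewrite mem_iota => /= kn ->; rewrite andbT /ncols -nth0.
by have := sorted_nth_le hlam (leq0n k); lia.
Qed.

(** * Branching rule for tableaux *)

(** The factorial power [(y | a)^q], when [b l] is [a_(l+1)]. *)
Definition fpow (R : comNzRingType) (b : nat -> R) (q : nat) (y : R) : R :=
  \prod_(0 <= l < q) (y - b l).

Definition ext0 k M (mu : {ffun 'I_k -> 'I_M}) (i : nat) : nat :=
  oapp (fun i => val (mu i)) 0%N (insub i).

Lemma ext0E k M (mu : {ffun 'I_k -> 'I_M}) (i : 'I_k) : ext0 mu i = mu i.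
Proof. by rewrite /ext0 valK. Qed.

Lemma ext0_out k M (mu : {ffun 'I_k -> 'I_M}) i : (k <= i)%N -> ext0 mu i = 0%N.
Proof. by move=> ki; rewrite /ext0 insubF // ltnNge ki. Qed.

Definition interlace k M (lam : nat -> nat) (mu : {ffun 'I_k -> 'I_M}) : bool :=
  [forall i : 'I_k, lam i.+1 <= mu i <= lam i]%N.

(** The cells of [lam] outside [mu] carry the largest entry, [k'] counted from 0. [M] bounds the
    parts and keeps the sum finite. *)
Fixpoint schur_rec (R : comNzRingType) (b z : nat -> R) (M k : nat)
    (lam : nat -> nat) : R :=
  if k is k'.+1 then
    \sum_(mu : {ffun 'I_k' -> 'I_M.+1} | interlace lam mu)
      (\prod_(i < k'.+1) \prod_(ext0 mu i <= j < lam i) (z k' - b (k' + j - i)%N)) *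
      schur_rec b z M k' (ext0 mu)
  else 1.

(** Follows from [y - b_l = (y - t) + (t - b_l)], one factor at a time. *)
Lemma fpow_telescope (R : comNzRingType) (b : nat -> R) (t y : R) p d :
  fpow b (p + d) y - (\prod_(p <= l < p + d) (t - b l)) * fpow b p y =
  (y - t) * \sum_(p <= q < p + d)
    (\prod_(q.+1 <= l < p + d) (t - b l)) * fpow b q y.
Proof.
elim: d => [|d IHd]; first by rewrite addn0 !big_geq // mul1r subrr mulr0.
rewrite addnS [\prod_(p <= l < _) _]big_nat_recr ?leq_addr //=.
rewrite [\sum_(p <= q < _) _]big_nat_recr ?leq_addr //=.
rewrite [X in _ + X * _]big_geq // mul1r.
have -> : \sum_(p <= q < p + d)
      (\prod_(q.+1 <= l < (p + d).+1) (t - b l)) * fpow b q y =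
    (t - b (p + d)%N) * \sum_(p <= q < p + d)
      (\prod_(q.+1 <= l < p + d) (t - b l)) * fpow b q y.
  rewrite mulr_sumr; apply: eq_big_nat => q /andP[_ qd].
  by rewrite big_nat_recr //=; ring.
have -> : fpow b (p + d).+1 y = fpow b (p + d) y * (y - b (p + d)%N).
  by rewrite /fpow big_nat_recr.
set S := \sum_(p <= q < _) _ in IHd *.
transitivity ((t - b (p + d)%N) * ((y - t) * S) + (y - t) * fpow b (p + d) y).
  by rewrite -IHd; ring.
ring.
Qed.

Lemma big_nat_ord_widen (R : nmodType) (F : nat -> R) m n M : (n <= M)%N ->
  \sum_(m <= i < n.+1) F i = \sum_(i < M.+1 | (m <= i <= n)%N) F i.
Proof.
move=> nM; by rewrite big_geq_mkord (big_ord_widen_cond M.+1).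
Qed.

(** After the reduction at [t = z k], dividing row [i] by [y - t] leaves a sum over [q] from
    [lam_(i+1)] to [lam_i]. By multilinearity, choosing one [q] per row is choosing an interlacing
    [mu]. *)
Lemma schur_rec_alt (R : comNzRingType) (b z : nat -> R) M k (lam : nat -> nat) :
  (forall i, (i.+1 < k)%N -> (lam i.+1 <= lam i)%N) -> (lam 0 <= M)%N ->
  vdm k z * schur_rec b z M k lam =
    alt k z (fun i => fpow b (lam i + k.-1 - i)).
Proof.
elim: k lam => [|k IHk] lam lam_dec lamM.
  by rewrite /vdm big_ord0 mul1r /alt det_mx00.
have lamM' i : (i <= k)%N -> (lam i <= M)%N.
  elim: i => // i IHi ik; apply: leq_trans (IHi (ltnW ik)); exact: lam_dec.
pose t := z k.
pose r i := \prod_(lam i.+1 + k - i.+1 <= l < lam i + k - i) (t - b l).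
have pE i : (i < k)%N ->
    (lam i + k - i = (lam i.+1 + k - i.+1) + (lam i - lam i.+1).+1)%N.
  by move=> ik; have := lam_dec i ik; lia.
rewrite (@alt_colop _ k z _ r); last first.
  move=> i ik; rewrite /r /fpow -/t mulrC -big_cat_nat //=.
  by move: (pE i ik); lia.
rewrite addnK.
rewrite vdmS -mulrA mulrCA.
pose c i y := \sum_(q < M.+1 | (lam i.+1 <= q <= lam i)%N)
  (\prod_(q + k - i <= l < lam i + k - i) (t - b l)) * fpow b (q + k.-1 - i) y.
rewrite (@eq_alt _ k z _ (fun i y => (y - z k) * c i y)); last first.
  move=> i j ik jk /=; rewrite /r pE // fpow_telescope -pE //; congr (_ * _).
  rewrite /c -(@big_nat_ord_widen _ (fun q =>
    (\prod_(q + k - i <= l < lam i + k - i) (t - b l)) *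
      fpow b (q + k.-1 - i) (z j))); last by apply: lamM'; apply: ltnW.
  (* The telescoped sum runs over exponents; a shift by [k - (i + 1)] makes it run over parts. *)
  rewrite -[(lam i.+1 + k - i.+1)%N](_ : lam i.+1 + (k - i.+1) = _)%N; last lia.
  rewrite -[(lam i + k - i)%N](_ : (lam i).+1 + (k - i.+1) = _)%N; last lia.
  rewrite big_addn addnK; apply: eq_big_nat => q _.
  congr (_ * fpow b _ _); last lia.
  by rewrite (_ : (q + (k - i.+1)).+1 = q + k - i)%N //; lia.
rewrite alt_scale [RHS]mulrCA; congr (_ * _).
rewrite (@alt_multilinear _ 'I_M.+1 k z (fun i q => lam i.+1 <= q <= lam i)%N
  (fun i q => \prod_(q + k - i <= l < lam i + k - i) (t - b l))
  (fun i q => fpow b (q + k.-1 - i))) //.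
rewrite /= !mulr_sumr; apply: eq_big => [mu|mu /forallP mu_int].
  by apply/forallP/familyP => h i; apply: h.
rewrite mulrCA.
have -> : \det (\matrix_(i < k, j < k) fpow b (mu i + k.-1 - i) (z j)) =
    alt k z (fun i => fpow b (ext0 mu i + k.-1 - i)).
  by congr (\det _); apply/matrixP=> i j; rewrite !mxE ext0E.
rewrite -IHk; first last.
- case: (posnP k) => [k0|k0]; first by rewrite ext0_out ?k0.
  by rewrite (ext0E mu (Ordinal k0)) -ltnS.
- move=> i ik; rewrite (ext0E mu (Ordinal ik)) (ext0E mu (Ordinal (ltnW ik))).
  have /andP[+ _] := mu_int (Ordinal (ltnW ik)).
  have /andP[_ +] := mu_int (Ordinal ik).
  exact: leq_trans.
(* [mu] has no part in row [k], so that whole row lies in the strip; it accounts for the bottom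
   entry at [t]. *)
rewrite big_ord_recr /= ext0_out // [RHS]mulrA; congr (_ * _).
rewrite [RHS]mulrC; congr (_ * _); last first.
  by rewrite /fpow; apply: eq_bigr => l _; rewrite addKn.
apply: eq_bigr => i _; rewrite ext0E.
rewrite -[(mu i + k - i)%N](_ : mu i + (k - i) = _)%N; last by have := ltn_ord i; lia.
rewrite big_addn (_ : lam i + k - i - (k - i) = lam i)%N; last by have := ltn_ord i; lia.
by apply: eq_bigr => l _; congr (_ - b _); have := ltn_ord i; lia.
Qed.

(** * Tableaux as chains of interlacing shapes *)

Definition in_shape n (lam : n.-tuple nat) (mu : nat -> nat) (c : cell lam) :
    bool :=
  (ccol c < mu (crow c))%N.

(* [T] is a semistandard tableau of shape [mu] with entries smaller than [k],
   extended by the dummy value [d] to the remaining cells of [lam]. *)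
Definition sub_tableau n (lam : n.-tuple nat) (d : 'I_n) (k : nat)
    (mu : nat -> nat) (T : filling lam) : bool :=
  [forall c, if in_shape mu c then crow c <= T c < k else T c == d]%N &&
  [forall c, forall e, in_shape mu c && in_shape mu e ==>
     ((crow c == crow e) && (ccol c < ccol e)%N ==> (T c <= T e)%N)
  && ((ccol c == ccol e) && (crow c < crow e)%N ==> (T c < T e)%N)].

Lemma sub_tableauP n (lam : n.-tuple nat) (d : 'I_n) k mu (T : filling lam) :
  reflect
    [/\ forall c, in_shape mu c -> (crow c <= T c < k)%N,
        forall c, ~~ in_shape mu c -> T c = d,
        forall c e, in_shape mu c -> in_shape mu e -> crow c = crow e ->
          (ccol c < ccol e)%N -> (T c <= T e)%N &
        forall c e, in_shape mu c -> in_shape mu e -> ccol c = ccol e ->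
          (crow c < crow e)%N -> (T c < T e)%N]
    (sub_tableau d k mu T).
Proof.
apply: (iffP andP) => [[/forallP h1 /'forall_forallP h2]|[h1 h2 h3 h4]]; split.
- by move=> c ic; have := h1 c; rewrite ic.
- by move=> c ic; have := h1 c; rewrite (negPf ic) => /eqP.
- move=> c e ic ie re ce; have := h2 c e.
  by rewrite ic ie re eqxx ce /= => /andP[].
- move=> c e ic ie ce re; have := h2 c e.
  by rewrite ic ie re ce eqxx /= => /andP[].
- apply/forallP => c; case: ifPn => ic; first exact: h1.
  by rewrite h2.
apply/'forall_forallP => c e; apply/implyP => /andP[ic ie].
apply/andP; split; apply/implyP => /andP[/eqP e1 e2]; first exact: h3.
exact: h4.
Qed.

Lemma ex_cell n (lam : n.-tuple nat) i j : (j < nth 0 lam i)%N ->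
  exists c : cell lam, crow c = i /\ ccol c = j.
Proof.
move=> ji; case: (ltnP i n) => iN; last first.
  by rewrite nth_default ?size_tuple // in ji.
have ji' : (j < tnth lam (Ordinal iN))%N by rewrite (tnth_nth 0%N).
by exists (Tagged (fun i => 'I_(tnth lam i)) (Ordinal ji')).
Qed.

Lemma ccol_lt n (lam : n.-tuple nat) (c : cell lam) :
  (ccol c < nth 0 lam (crow c))%N.
Proof. by rewrite /crow -tnth_nth; apply: ltn_ord. Qed.

Lemma prod_cells (R : comNzRingType) n (lam : n.-tuple nat)
    (mu nu : nat -> nat) (G : nat -> nat -> R) :
  (forall i, (mu i <= nth 0 lam i)%N) ->
  \prod_(c : cell lam | in_shape mu c && ~~ in_shape nu c)
      G (crow c) (ccol c) =
    \prod_(i < n) \prod_(nu i <= j < mu i) G i j.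
Proof.
move=> mulam.
transitivity (\prod_(i < n) \prod_(j < tnth lam i | (j < mu i)%N && ~~ (j < nu i)%N)
    G i j); first by rewrite sig_big_dep.
apply: eq_bigr => i _; rewrite big_geq_mkord.
rewrite (big_ord_widen_cond (tnth lam i)); last by rewrite (tnth_nth 0%N).
by apply: eq_bigl => j; rewrite -leqNgt andbC.
Qed.

Section Branching.
Variables (R : comNzRingType) (n : nat) (lam : n.-tuple nat) (d : 'I_n).
Variables (b z : nat -> R) (M : nat).
Hypothesis lamM : forall i, (nth 0 lam i <= M)%N.

Let wt (c : cell lam) (k : nat) : R := z k - b (k + ccol c - crow c)%N.

Definition tableau_sum (k : nat) (mu : nat -> nat) : R :=
  \sum_(T : filling lam | sub_tableau d k mu T)
    \prod_(c | in_shape mu c) wt c (T c).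

Definition small_entries k (mu : nat -> nat) (T : filling lam)
    (nu : nat -> nat) : bool :=
  [forall c, in_shape mu c ==> ((T c < k)%N == in_shape nu c)].

(** Rows increase weakly, so the entries below [k] fill an initial segment; the induction lengthens
    the inspected part of the row. *)
Lemma row_threshold k (mu : nat -> nat) (T : filling lam) i r :
  (mu i <= nth 0 lam i)%N -> sub_tableau d k.+1 mu T -> (r <= mu i)%N ->
  exists2 m, (m <= r)%N & forall c, crow c = i -> (ccol c < r)%N ->
    (T c < k)%N = (ccol c < m)%N.
Proof.
move=> mulam /sub_tableauP[_ _ Trow _]; elim: r => [|r IHr] rmu.
  by exists 0%N.
have [e [er ec]] := ex_cell (leq_trans rmu mulam).
have ie : in_shape mu e by rewrite /in_shape er ec.
have eqe c : crow c = i -> ccol c = r -> T c = T e.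
  move=> cr cc; congr (T _); rewrite -{}er in cr; rewrite -{}ec in cc.
  case: c e cr cc {ie} => [i1 j1] [i2 j2]; rewrite /crow /ccol /= => /val_inj ei.
  by case: i2 / ei j2 => j2 /val_inj ->.
have [Tek|Tek] := ltnP (T e) k.
  exists r.+1 => // c cr cr1; rewrite cr1.
  have /predU1P[cc|cc] : (ccol c == r) || (ccol c < r)%N by rewrite -leq_eqVlt.
    by rewrite eqe.
  apply: leq_ltn_trans Tek; apply: Trow => //.
  - by rewrite /in_shape cr; apply: ltn_trans cc rmu.
  - by rewrite cr er.
  by rewrite ec.
have [m mr mP] := IHr (ltnW rmu); exists m; first exact: leqW.
move=> c cr cr1.
have /predU1P[cc|] : (ccol c == r) || (ccol c < r)%N by rewrite -leq_eqVlt.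
  by rewrite eqe // cc !ltnNge Tek mr.
exact: mP.
Qed.

Variables (k : nat) (mu : nat -> nat).
Hypotheses (kn : (k < n)%N) (mulam : forall i, (mu i <= nth 0 lam i)%N).
Hypothesis mu_dec : forall i, (mu i.+1 <= mu i)%N.
Hypothesis mu0 : forall i, (k < i)%N -> mu i = 0%N.

Lemma mu_anti i j : (i <= j)%N -> (mu j <= mu i)%N.
Proof.
move=> ij; rewrite -(subnK ij); elim: (j - i)%N => // m IHm.
by rewrite addSn; apply: leq_trans (mu_dec _) IHm.
Qed.

(** The thresholds of the rows form [nu]. Stated as an equality with [nu' == nu], this collapses a
    sum over [nu'] to one term. *)
Lemma small_entries_uniq T : sub_tableau d k.+1 mu T ->
  exists nu : {ffun 'I_k -> 'I_M.+1},
    forall nu' : {ffun 'I_k -> 'I_M.+1},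
      interlace mu nu' && small_entries k mu T (ext0 nu') = (nu' == nu).
Proof.
move=> tT; have /sub_tableauP[Tb _ Trow Tcol] := tT.
have /fin_all_exists[m mP] (i : 'I_k) : exists m : 'I_M.+1, (m <= mu i)%N /\
    forall c : cell lam, crow c = i -> in_shape mu c -> (T c < k)%N = (ccol c < m)%N.
  have [m mmu mP] := row_threshold (mulam i) tT (leqnn _).
  have mM : (m < M.+1)%N by rewrite ltnS (leq_trans mmu) ?(leq_trans (mulam i)).
  by exists (Ordinal mM); split=> // c cr; rewrite /in_shape cr; apply: mP.
exists (finfun m) => nu'; apply/andP/eqP => [[/forallP int /forallP sm]|->].
  apply/ffunP => i; apply: val_inj; rewrite ffunE /=.
  have [mmu mi] := mP i.
  have /andP[_ nmu] := int i.
  apply/eqP; rewrite eqn_leq; apply/andP; split; rewrite leqNgt; apply/negP => lt.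
    have [c [cr cc]] := ex_cell (leq_trans (leq_trans lt nmu) (mulam i)).
    have ic : in_shape mu c by rewrite /in_shape cr cc; apply: leq_trans lt nmu.
    have := implyP (sm c) ic; rewrite (mi c cr ic) cc ltnn /in_shape cr cc ext0E.
    by rewrite lt.
  have [c [cr cc]] := ex_cell (leq_trans (leq_trans lt mmu) (mulam i)).
  have ic : in_shape mu c by rewrite /in_shape cr cc; apply: leq_trans lt mmu.
  have := implyP (sm c) ic; rewrite (mi c cr ic) cc lt /in_shape cr cc ext0E.
  by rewrite ltnn.
split.
  apply/forallP => i; rewrite ffunE; have [-> mi] := mP i; rewrite andbT.
  (* Otherwise the cell of row [i + 1] in column [m i] has an entry at most [k], below an entry at
     least [k], and its column does not increase strictly. *)
  rewrite leqNgt; apply/negP => lt.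
  have [c [cr cc]] := ex_cell (leq_trans lt (mulam _)).
  have ic : in_shape mu c by rewrite /in_shape cr cc.
  have [e [er ec]] := ex_cell (leq_trans (leq_trans lt (mu_dec _)) (mulam i)).
  have ie : in_shape mu e.
    by rewrite /in_shape er ec; apply: leq_trans lt (mu_dec _).
  have := mi e er ie; rewrite ec ltnn => /negbT; rewrite -leqNgt => kTe.
  have /andP[_ Tc] := Tb c ic.
  have : (T e < T c)%N by apply: Tcol => //; rewrite ?cc ?ec ?cr ?er.
  by move: Tc; lia.
apply/forallP => c; apply/implyP => ic; apply/eqP.
have [ck|ck] := ltnP (crow c) k.
  by rewrite (proj2 (mP (Ordinal ck))) // /in_shape (ext0E _ (Ordinal ck)) ffunE.
rewrite /in_shape ext0_out // ltn0.
by have /andP[rT _] := Tb c ic; apply/negbTE; rewrite -leqNgt (leq_trans ck).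
Qed.

(** Tableaux are sorted by the shape [nu] of their entries below [k]; for fixed [nu], erasing the
    entries [k] is a bijection onto the tableaux of shape [nu]. *)
Lemma tableau_sumS :
  tableau_sum k.+1 mu =
    \sum_(nu : {ffun 'I_k -> 'I_M.+1} | interlace mu nu)
      (\prod_(i < k.+1) \prod_(ext0 nu i <= j < mu i) (z k - b (k + j - i)%N)) *
      tableau_sum k (ext0 nu).
Proof.
rewrite /tableau_sum.
transitivity (\sum_(T : filling lam | sub_tableau d k.+1 mu T)
  \sum_(nu : {ffun 'I_k -> 'I_M.+1} |
      interlace mu nu && small_entries k mu T (ext0 nu))
    \prod_(c | in_shape mu c) wt c (T c)).
  apply: eq_bigr => T tT; have [nu nuP] := small_entries_uniq tT.
  by rewrite (eq_bigl _ _ nuP) big_pred1_eq.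
rewrite (exchange_big_dep (fun nu => interlace mu nu)) /=; last first.
  by move=> T nu _ /andP[].
apply: eq_bigr => nu nu_intb; have /forallP nu_int := nu_intb.
have nu_mu i : (ext0 nu i <= mu i)%N.
  have [ik|ik] := ltnP i k; last by rewrite ext0_out.
  by rewrite (ext0E nu (Ordinal ik)); have /andP[] := nu_int (Ordinal ik).
have mu_nu i : (mu i.+1 <= ext0 nu i)%N.
  have [ik|ik] := ltnP i k; last by rewrite mu0.
  by rewrite (ext0E nu (Ordinal ik)); have /andP[] := nu_int (Ordinal ik).
have sub (c : cell lam) : in_shape (ext0 nu) c -> in_shape mu c.
  by move=> ic; apply: leq_trans ic (nu_mu _).
(* The cells of [mu] outside [nu] form a horizontal strip. *)
have strip (c e : cell lam) : in_shape mu e -> ccol c = ccol e -> (crow c < crow e)%N ->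
    in_shape (ext0 nu) c.
  rewrite /in_shape => ie -> re; apply: leq_trans ie (leq_trans _ (mu_nu _)).
  exact: mu_anti.
pose kk := Ordinal kn.
(* [up] writes [k] on the strip and [down] restores the dummy there. *)
pose up (T : filling lam) : filling lam := [ffun c =>
  if in_shape (ext0 nu) c then T c else if in_shape mu c then kk else d].
pose down (T : filling lam) : filling lam := [ffun c =>
  if in_shape (ext0 nu) c then T c else d].
rewrite (reindex_onto up down) /=; last first.
  move=> T /andP[tT /andP[_ /forallP sm]]; apply/ffunP => c; rewrite !ffunE.
  have /sub_tableauP[Tb Td _ _] := tT.
  case: (boolP (in_shape (ext0 nu) c)) => // inu; case: ifPn => [imu|/Td -> //].
  have := implyP (sm c) imu; rewrite (negPf inu) => /eqP/negbT; rewrite -leqNgt => kT.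
  by apply/eqP; rewrite -val_eqE eqn_leq kT /= -ltnS; have /andP[] := Tb c imu.
rewrite mulr_sumr; apply: eq_big => [T|T _]; last first.
  rewrite (bigID (in_shape (ext0 nu))) /= mulrC; congr (_ * _); last first.
    apply: eq_big => c; last by move=> /andP[_ ic]; rewrite ffunE ic.
    by case: (boolP (in_shape (ext0 nu) c)) => [/sub ->|]; rewrite ?andbF.
  rewrite (big_ord_widen n (fun i =>
     \prod_(ext0 nu i <= j < mu i) (z k - b (k + j - i)%N))) // [RHS]big_mkcond /=.
  transitivity (\prod_(c : cell lam | in_shape mu c && ~~ in_shape (ext0 nu) c)
    wt c k).
    apply: eq_bigr => c /andP[imu /negPf inu].
    by rewrite ffunE inu imu.
  rewrite (prod_cells _ (fun i j => z k - b (k + j - i)%N)) //.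
  apply: eq_bigr => i _; case: ifPn => //; rewrite -leqNgt => ki.
  by rewrite mu0 // big_geq.
apply/idP/idP.
  case/andP => /andP[/sub_tableauP[Tb Td Trow Tcol] /andP[_ /forallP sm]] /eqP Te.
  have upE c : in_shape (ext0 nu) c -> up T c = T c by move=> ic; rewrite ffunE ic.
  apply/sub_tableauP; split.
  - move=> c ic; have := implyP (sm c) (sub c ic); rewrite ic upE // => /eqP ->.
    by rewrite andbT -(upE _ ic); have /andP[] := Tb c (sub c ic).
  - by move=> c /negPf ic; rewrite -Te ffunE ic.
  - move=> c e ic ie; rewrite -!upE //; apply: Trow; exact: sub.
  - move=> c e ic ie; rewrite -!upE //; apply: Tcol; exact: sub.
case/sub_tableauP => Tb Td Trow Tcol; apply/andP; split; last first.
  apply/eqP/ffunP => c; rewrite !ffunE.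
  by case: (boolP (in_shape (ext0 nu) c)) => // /Td ->.
apply/andP; split; last first.
  rewrite nu_intb /=.
  apply/forallP => c; apply/implyP => imu; rewrite ffunE imu.
  by case: ifPn => [/Tb/andP[_ ->]|_] //=; rewrite ltnn.
apply/sub_tableauP; split.
- move=> c imu; rewrite ffunE imu; case: ifPn => [/Tb/andP[-> /ltnW]|_] //=.
  rewrite ltnS leqnn andbT leqNgt; apply/negP => /mu0 m0.
  by rewrite /in_shape m0 in imu.
- by move=> c imu; rewrite ffunE (negPf imu) ifN //; apply: contra imu => /sub.
- move=> c e imu iemu re ce; rewrite !ffunE imu iemu.
  case: (ifPn (in_shape (ext0 nu) e)) => ie.
    have ic : in_shape (ext0 nu) c.
      by rewrite /in_shape re; apply: ltn_trans ce ie.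
    by rewrite ic; apply: Trow.
  by case: ifPn => [/Tb/andP[_ /ltnW]|_] //=.
- move=> c e imu iemu ce re; rewrite !ffunE imu iemu (strip c e) //.
  have ic := strip c e iemu ce re.
  by case: ifPn => ie; [apply: Tcol | have /andP[] := Tb c ic].
Qed.

End Branching.

Lemma tableau_sumE (R : comNzRingType) n (lam : n.-tuple nat) (d : 'I_n)
    (b z : nat -> R) M k (mu : nat -> nat) :
  (forall i, (nth 0 lam i <= M)%N) -> (k <= n)%N ->
  (forall i, (mu i <= nth 0 lam i)%N) -> (forall i, (mu i.+1 <= mu i)%N) ->
  (forall i, (k <= i)%N -> mu i = 0%N) ->
  tableau_sum lam d b z k mu = schur_rec b z M k mu.
Proof.
move=> lamM; elim: k mu => [|k IHk] mu kn mulam mu_dec mu0.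
  have out (c : cell lam) : in_shape mu c = false by rewrite /in_shape mu0.
  rewrite /tableau_sum (big_pred1 [ffun=> d]) => [|T /=].
    by rewrite big_pred0.
  apply/sub_tableauP/eqP => [[_ Td _ _]|->].
    by apply/ffunP => c; rewrite ffunE Td ?out.
  by split=> c; rewrite ?out // ffunE.
rewrite (tableau_sumS d b z lamM) //=; apply: eq_bigr => nu /forallP nu_int.
congr (_ * _); apply: IHk => [|i|i|i ik]; first exact: ltnW.
- have [ik|ik] := ltnP i k; last by rewrite ext0_out.
  apply: leq_trans (mulam i); rewrite (ext0E nu (Ordinal ik)).
  by have /andP[] := nu_int (Ordinal ik).
- have [ik|ik] := ltnP i.+1 k; last by rewrite ext0_out.
  rewrite (ext0E nu (Ordinal ik)) (ext0E nu (Ordinal (ltnW ik))).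
  have /andP[_ le1] := nu_int (Ordinal ik).
  have /andP[le2 _] := nu_int (Ordinal (ltnW ik)).
  exact: leq_trans le1 le2.
exact: ext0_out.
Qed.

(** [lam] decreases, so a cell has cells above it up to the first row, and entries grow strictly
    down the column. *)
Lemma semistandard_crow_le n (lam : n.-tuple nat) (T : filling lam)
    (c : cell lam) : sorted geq lam -> semistandard T -> (crow c <= T c)%N.
Proof.
move=> hlam /'forall_forallP ssT.
move: {2}(crow c) (erefl (crow c)) => i.
elim: i c => [|i IHi] c cr; rewrite cr //.
have lt : (ccol c < nth 0 lam i)%N.
  by apply: leq_trans (ccol_lt c) _; rewrite cr; apply: sorted_nth_le.
have [e [er ec]] := ex_cell lt.
apply: leq_ltn_trans (_ : i <= T e)%N _; first by rewrite -{1}er IHi.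
by have /andP[_] := ssT e c; rewrite ec er cr eqxx leqnn.
Qed.

Lemma factorial_schurE (F : fieldType) n (lam : n.-tuple nat) (x a : nat -> F) :
  (0 < n)%N -> sorted geq lam ->
  factorial_schur lam x a =
    schur_rec (fun l => a l.+1) (fun k => x k.+1) (head 0%N lam) n (nth 0%N lam).
Proof.
move=> n0 hlam; pose d := Ordinal n0.
have lamM i : (nth 0 lam i <= head 0 lam)%N by rewrite -nth0 sorted_nth_le.
rewrite -(@tableau_sumE _ _ lam d) //; last first.
- by move=> i ni; rewrite nth_default ?size_tuple.
- by move=> i; apply: sorted_nth_le.
have inL (c : cell lam) : in_shape (nth 0%N lam) c by apply: ccol_lt.
apply: eq_big => [T|T ssT].
  apply/idP/sub_tableauP => [ssT|[_ _ Trow Tcol]].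
    split=> c.
    - by move=> _; rewrite semistandard_crow_le //= ltn_ord.
    - by rewrite inL.
    - move=> e _ _ re ce; have /'forall_forallP/(_ c e)/andP[+ _] := ssT.
      by rewrite re ce eqxx.
    - move=> e _ _ ce re; have /'forall_forallP/(_ c e)/andP[_ +] := ssT.
      by rewrite re ce eqxx.
  apply/'forall_forallP => c e; apply/andP; split.
    by apply/implyP => /andP[/eqP re ce]; apply: Trow.
  by apply/implyP => /andP[/eqP ce re]; apply: Tcol.
apply: eq_big => [c|c _]; first by rewrite inL.
(* [crow c <= T c] makes the natural subtraction exact. *)
congr (_ - a _); have := semistandard_crow_le c hlam ssT; lia.
Qed.

(** * Comparison *)

(** With [schur_rec_rmorph], this specialises an identity over [{poly F}] to [F]. *)
Lemma zrec_rmorph (R S : comNzRingType) (f : {rmorphism R -> S})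
    (u z : nat -> R) (u' z' : nat -> S) k bs :
  (forall i, f (u i) = u' i) -> (forall i, f (z i) = z' i) ->
  f (zrec u z k bs) = zrec u' z' k bs.
Proof.
move=> fu fz; elim: k bs => [|k IHk] bs /=; first by rewrite rmorph_nat.
have row_rmorph j h Psi Psi' : (forall v, f (Psi v) = Psi' v) ->
    f (row (z k) u j h bs Psi) = row (z' k) u' j h bs Psi'.
  elim: bs j h Psi Psi' => [|b bs IHbs] j h Psi Psi' eP /=.
    by case: h; rewrite ?rmorph0.
  rewrite rmorph_sum; apply: eq_bigr => h' _.
  rewrite rmorph_sum; apply: eq_bigr => b' _.
  rewrite rmorphM; congr (_ * _); last by apply: IHbs => v; apply: eP.
  rewrite /vertex_weight.
  by do 3?case: ifP => _; rewrite ?rmorphB ?rmorphM ?rmorph1 ?rmorph0 ?fu ?fz.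
exact: row_rmorph.
Qed.

Lemma schur_rec_rmorph (R S : comNzRingType) (f : {rmorphism R -> S})
    (b z : nat -> R) (b' z' : nat -> S) M k lam :
  (forall i, f (b i) = b' i) -> (forall i, f (z i) = z' i) ->
  f (schur_rec b z M k lam) = schur_rec b' z' M k lam.
Proof.
move=> fb fz; elim: k lam => [|k IHk] lam /=; first exact: rmorph1.
rewrite rmorph_sum; apply: eq_bigr => mu _; rewrite rmorphM IHk; congr (_ * _).
rewrite rmorph_prod; apply: eq_bigr => i _.
by rewrite rmorph_prod; apply: eq_bigr => j _; rewrite rmorphB fb fz.
Qed.

Lemma vdm_zrec_schur_rec (R : comNzRingType) n (lam : n.-tuple nat)
    (u b z : nat -> R) :
  sorted geq lam -> (forall l, b l * u l = 1) ->
  vdm n z * (zrec u (fun i => z (n.-1 - i)%N) n (codom (lam_top lam)) *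
      \prod_(p <- shifted_part lam) \prod_(l < p) b l) =
  vdm n z * ((\prod_(k < n) z k ^+ k) *
      schur_rec b z (head 0%N lam) n (nth 0%N lam)).
Proof.
move=> hlam bu; rewrite [RHS]mulrCA schur_rec_alt; last first.
- by rewrite nth0.
- by move=> i _; apply: sorted_nth_le.
pose z' i := z (n.-1 - i)%N.
pose p i := (nth 0 lam i + n.-1 - i)%N.
have := zrec_altl u n z' (codom (lam_top lam)).
rewrite cols_lam_top // /altl size_map size_mkseq eqxx.
rewrite (@eq_alt _ n z' _ (fun i => fbinom u (p i))); last first.
  by move=> i j iN _; rewrite (nth_map 0%N) ?size_mkseq // nth_mkseq.
(* Reversing the variables gives the Vandermonde determinant and the alternant the same sign. *)
rewrite vdm_alt !alt_rev -vdm_alt.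
set sgn := (-1) ^+ _; move=> E.
have Esgn : vdm n z * zrec u z' n (codom (lam_top lam)) =
    (\prod_(i < n) z' i ^+ (n.-1 - i)) * alt n z (fun i => fbinom u (p i)).
  apply: (can_inj (signrMK (perm (@rev_ord_inj n)))).
  by rewrite -/sgn mulrA E mulrCA.
rewrite mulrA Esgn -mulrA; congr (_ * _).
  rewrite (reindex_inj rev_ord_inj); apply: eq_bigr => i _.
  rewrite /z'; have -> : (n.-1 - rev_ord i = i)%N; last by [].
  by rewrite /=; have := ltn_ord i; lia.
have -> : \prod_(q <- shifted_part lam) \prod_(l < q) b l =
    \prod_(i < n) \prod_(l < p i) b l.
  rewrite big_map -(big_mkord xpredT (fun i => \prod_(l < p i) b l)).
  by rewrite /index_iota subn0.
(* Multiplying row [i] by the first [p i] values of [b] turns [fbinom] into [fpow], since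
   [b l * u l = 1]. *)
rewrite mulrC -(alt_row_scale n z (fun i => \prod_(l < p i) b l)).
apply: eq_alt => i j _ _; rewrite /fbinom /fpow big_mkord -big_split.
by apply: eq_bigr => l _ /=; rewrite mulrBr mulr1 mulrCA bu mulr1.
Qed.

Lemma zrec_schur_rec (F : fieldType) n (lam : n.-tuple nat) (x a : nat -> F) :
  sorted geq lam -> (forall l, a l != 0) ->
  zrec (fun l => (a l)^-1) (fun i => x (n.-1 - i)%N) n (codom (lam_top lam)) *
      \prod_(p <- shifted_part lam) \prod_(l < p) a l =
  (\prod_(k < n) x k ^+ k) * schur_rec a x (head 0%N lam) n (nth 0%N lam).
Proof.
move=> hlam a0.
(* Distinct powers of ['X] separate the variables, and positive exponents let ['X = 0] give back
   [x]. *)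
pose z k : {poly F} := (x k)%:P + 'X^(k.+1).
have vdm0 : vdm n z != 0.
  apply/prodf_neq0 => i _; apply/prodf_neq0 => j _.
  (* For [j < i], the coefficient of degree [i + 1] in [z j - z i] is -1. *)
  apply/eqP => /(congr1 (fun q : {poly F} => q`_i.+1)) /eqP.
  rewrite /z !coefE /= eqxx eqSS (gtn_eqF (ltn_ord j)) !add0r.
  by rewrite oppr_eq0 oner_eq0.
have ba l : (a l)%:P * ((a l)^-1)%:P = 1 :> {poly F}.
  by rewrite -polyCM divff.
have /(mulfI vdm0)/(congr1 (horner_eval 0)) := vdm_zrec_schur_rec z hlam ba.
have zE k : horner_eval 0 (z k) = x k.
  by rewrite /horner_eval /z !hornerE expr0n addr0.
have cE (c : F) : horner_eval 0 c%:P = c by rewrite /horner_eval hornerC.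
rewrite !rmorphM !rmorph_prod /=.
rewrite (zrec_rmorph _ _ (fun l => cE (a l)^-1) (fun i => zE (n.-1 - i)%N)).
rewrite (schur_rec_rmorph _ _ _ (fun l => cE (a l)) zE).
under eq_bigr => p _.
  rewrite rmorph_prod /=; under eq_bigr => l _ do rewrite cE; over.
move=> ->; congr (_ * _); apply: eq_bigr => k _.
by rewrite rmorphXn /= zE.
Qed.

Lemma exp_count (R : comNzRingType) (y : R) (P : pred nat) (s : seq nat) :
  y ^+ count P s = \prod_(p <- s) (if P p then y else 1).
Proof.
elim: s => [|p s IHs]; first by rewrite big_nil.
by rewrite big_cons /= exprD IHs; case: (P p).
Qed.

(** Both sides multiply, over the cells of the diagram of [nu], the [a] of the column number: by
    columns on the left, by rows on the right. *)
Lemma mexp_conj_part (R : comUnitRingType) (a : nat -> R) (nu : seq nat) :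
  (forall p, p \in nu -> (p <= head 0 nu)%N) ->
  mexp a (conj_part nu) = \prod_(p <- nu) \prod_(l < p) a l.+1.
Proof.
move=> nu_le; rewrite /mexp /conj_part size_map size_iota.
under [LHS]eq_bigr => k _.
  rewrite (nth_map 0%N) ?size_iota // nth_iota // add1n exp_count; over.
rewrite exchange_big big_seq [RHS]big_seq; apply: eq_bigr => p pnu /=.
by rewrite (big_ord_widen _ (fun l => a l.+1) (nu_le p pnu)) [RHS]big_mkcond.
Qed.

Lemma add_part_rho n (lam : n.-tuple nat) :
  add_part lam (rho n) = shifted_part lam.
Proof.
have sz : size (zip lam (rho n)) = n.
  by rewrite size_zip size_tuple size_mkseq minnn.
apply: (@eq_from_nth _ 0%N) => [|i]; rewrite size_map sz ?size_mkseq // => iN.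
rewrite (nth_map (0%N, 0%N)) ?sz // nth_zip ?size_mkseq ?size_tuple //=.
by rewrite !nth_mkseq //; lia.
Qed.

Theorem theorem1 (F : fieldType) (n : nat) (lam : n.-tuple nat)
    (x a : nat -> F)
    (hn : (1 <= n)%N) (hlam : sorted geq lam)
    (ha : forall j : nat, (1 <= j)%N -> a j != 0) :
  partition_function lam x a =
    mexp x (delta n) / mexp a (conj_part (add_part lam (rho n)))
      * factorial_schur lam x a.
Proof.
have deltaE : mexp x (delta n) = \prod_(k < n) x k.+1 ^+ k.
  rewrite /mexp size_iota; apply: eq_bigr => k _.
  by rewrite nth_iota.
have conjE : mexp a (conj_part (add_part lam (rho n))) =
    \prod_(p <- shifted_part lam) \prod_(l < p) a l.+1.
  rewrite add_part_rho; apply: mexp_conj_part => p /mapP[i].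
  rewrite mem_iota /= => iN ->; rewrite -nth0 nth_mkseq // subn0.
  by have := sorted_nth_le hlam (leq0n i); lia.
have conj0 : \prod_(p <- shifted_part lam) \prod_(l < p) a l.+1 != 0.
  rewrite prodf_seq_neq0; apply/allP => p _ /=.
  by apply/prodf_neq0 => l _; apply: ha.
rewrite conjE deltaE factorial_schurE // partition_function_zrec //.
rewrite mulrAC; apply: (canRL (mulfK conj0)).
exact: (zrec_schur_rec (fun k => x k.+1) hlam (fun l => ha l.+1 isT)).
Qed.
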